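(* For a non-autonomous discrete dynamical system $(X,f_{1,\infty})$ the following are equivalent: (i) The system $(X,f_{1,\infty})$ is very strongly transitive. (ii) For all $\epsilon>0$, there exists $N\in\mathbb{N}$ such that $O_N^-(x,f_{1,\infty})$ is $\epsilon$ dense in $X$ for every $x\in X$.
   Context: $\mathbb{N}=\{1,2,3,\dots\}$. A non-autonomous discrete dynamical system (NDDS) is a pair $(X,f_{1,\infty})$ where $X$ is a compact metric space and $f_{1,\infty}=(f_n)_{n\in\mathbb{N}}$ is a sequence of continuous maps $f_n:X\to X$. For $n\in\mathbb{N}$, $f_1^n:=f_n\circ\cdots\circ f_1$, and $f_1^{-n}(x)=(f_1^n)^{-1}(\{x\})$ denotes the preimage. For $N\in\mathbb{N}$, $O_N^-(x,f_{1,\infty})=\bigcup_{1\le n\le N}f_1^{-n}(x)$. The system is very strongly transitive if for every nonempty open $V\subset X$ there exists $k\in\mathbb{N}$ such that $\bigcup_{n=1}^{k}f_1^n(V)=X$. For $\epsilon>0$, a subset of $X$ is $\epsilon$ dense if it intersects every open ball of radius $\epsilon$ in $X$. *)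

(* Defs.v *)
From HB Require Import structures.
From mathcomp Require Import all_boot all_order all_algebra.
From mathcomp Require Import all_classical all_reals all_analysis.

Set Implicit Arguments.
Unset Strict Implicit.
Unset Printing Implicit Defensive.

Local Open Scope classical_set_scope.
Local Open Scope ring_scope.

(* Sequences of maps are indexed by n >= 1: in f : nat -> X -> X the entry f 0
   is a dummy that never occurs in any composition below. *)

(* f_1^n = f_n \o ... \o f_1 *)
Fixpoint iter_from1 (X : Type) (f : nat -> X -> X) (n : nat) : X -> X :=
  if n is m.+1 then f m.+1 \o iter_from1 f m else id.

Definition backward_orbit (X : Type) (f : nat -> X -> X) (N : nat) (x : X) :
    set X :=
  \bigcup_(n in [set n | (1 <= n <= N)%N]) (iter_from1 f n @^-1` [set x]).

Definition very_strongly_transitive (X : topologicalType)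
    (f : nat -> X -> X) : Prop :=
  forall V : set X, open V -> V !=set0 ->
    exists2 k : nat, (1 <= k)%N &
      \bigcup_(n in [set n | (1 <= n <= k)%N]) (iter_from1 f n @` V) = [set: X].

(* On a metricType, ball y e is [set z | mdist y z < e] (ballEmdist). *)
Definition eps_dense (R : realType) (X : metricType R) (e : R) (A : set X) :
    Prop :=
  forall y : X, A `&` ball y e !=set0.

(* Main.v *)
Require Import Defs.
From HB Require Import structures.
From mathcomp Require Import all_boot all_order all_algebra.
From mathcomp Require Import all_classical all_reals all_analysis.

Local Open Scope classical_set_scope.
Local Open Scope ring_scope.

(** A point [x] lies in the image of [V] under [iter_from1 f n] iff its preimage meets [V]. So the
    images up to [k] cover [X] iff every [backward_orbit f k x] meets [V]. Thus (ii) is transitivity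
    for balls with a bound uniform in the center, which compactness supplies. *)

Theorem theorem3p5 (R : realType) (X : metricType R) (f : nat -> X -> X)
    (X_compact : compact [set: X])
    (f_continuous : forall n : nat, (1 <= n)%N -> continuous (f n)) :
  very_strongly_transitive f <->
  (forall e : R, 0 < e ->
     exists2 N : nat, (1 <= N)%N &
       forall x : X, eps_dense e (backward_orbit f N x)).
Proof.
split=> [f_trans e e_gt0|f_dense V V_open [v Vv]].
- (* Transitivity applied to the ball of radius e/2 around y gives a bound k
     that serves every center in that ball; compactness makes it uniform. *)
  pose P (N : nat) (y : X) :=
    forall x, backward_orbit f N x `&` ball y e !=set0.
  have e2_gt0 : 0 < e / 2 by rewrite Num.Theory.divr_gt0.
  (* Letting [N] tend to [\oo] alongside [y'] lets [compact_near_coveringP] replace a finite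
     subcover and the maximum of its bounds. *)
  have P_local (y : X) : [set: X] y -> \forall y' \near y & N \near \oo, P N y'.
    move=> _; have [] := f_trans (ball y (e / 2))^°.
    + exact: open_interior.
    + by exists y; apply: nbhsx_ballx.
    move=> k _ cover_k.
    exists (ball y (e / 2), [set N | (k <= N)%N]).
      by split; [exact: nbhsx_ballx | exact: nbhs_infty_ge].
    move=> [y' N] [/= yy' kN] x.
    have : [set: X] x by [].
    rewrite -cover_k => -[n /= /andP[n_gt0 nk] [z Vz fz]].
    exists z; split; first by exists n => //=; rewrite n_gt0 (leq_trans nk).
    by apply: (@ball_splitr _ _ y) => //; exact: interior_subset Vz.
  have [N _ P_N] :=
    (compact_near_coveringP _).1 X_compact _ \oo P _ P_local.
  (* The threshold [N] could be 0; [P_N] covers every larger index. *)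
  exists (maxn 1 N); first exact: leq_maxl.
  by move=> x y; apply: P_N => //=; exact: leq_maxr.
- have /nbhs_ballP[e /= e_gt0 ball_V] : nbhs v V by exact: open_nbhs_nbhs.
  have [N N_gt0 dense_N] := f_dense e e_gt0.
  exists N => //; apply/seteqP; split=> // x _.
  have [z [[n nN fz] vz]] := dense_N x v.
  by exists n => //; exists z => //; exact: ball_V.
Qed.
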